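(* Let $P$ be a poset such that, for every nonempty subset $A$ of $P$ without a fusion in $P$, $\downarrow A$ is atomic. Then the inclusion map $\alpha\colon P\hookrightarrow H(P)$ is a fusion-completion of $P$.
   Context: In a poset $P$, $x\circ y$ (overlap) means that there is $z\in P$ with $z\le x$ and $z\le y$. For $A\subseteq P$, $\downarrow A=\{y\in P\mid y\le a\text{ for some }a\in A\}$. An atom of a poset is an element $x$ such that $y\le x$ implies $y=x$; a poset is atomic if every element has an atom below it (or equal to it); $\operatorname{Atoms}(P)$ is the set of atoms of $P$. For $x\in P$ let $\mathsf{O}(x)=\{y\in P\mid x\circ y\}$, and for $A\subseteq P$ let $\mathsf{O}(A)=\bigcup\{\mathsf{O}(x)\mid x\in A\}$. For $\varnothing\ne A\subseteq P$, an element $x\in P$ is a fusion of $A$ if for every $y\in P$: $y\circ x$ if and only if $y\circ z$ for some $z\in A$. A poset is fusion-complete if every nonempty subset has a fusion. An order-embedding is a map $f$ with $x\le y\iff f(x)\le f(y)$. A map $f\colon P\to M$ is: $\circ$-reflecting if $f(x)\circ f(y)$ implies $x\circ y$; fusion-preserving if $f(x)$ is a fusion of $f(A)$ in $M$ whenever $x\in P$ is a fusion of $A\subseteq P$; fusion-dense if for every $m\in M$ there is $A\subseteq P$ such that $m$ is a fusion of $f(A)$ in $M$. A fusion-completion of $P$ is a fusion-complete poset $M$ together with a $\circ$-reflecting, fusion-preserving and fusion-dense order-embedding $e\colon P\to M$. $H(P)$ is the set $P\cup\{f_{\mathsf{O}(A)}\mid \varnothing\neq A\subseteq P\text{ has no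 fusion in }P\}$, where the $f_{\mathsf{O}(A)}$ are new formal elements not in $P$, indexed by the sets $\mathsf{O}(A)$ (so $f_{\mathsf{O}(A)}=f_{\mathsf{O}(B)}$ iff $\mathsf{O}(A)=\mathsf{O}(B)$). Its order $\sqsubseteq$ is: on $P$ the given order; each $f_{\mathsf{O}(A)}\sqsubseteq f_{\mathsf{O}(A)}$; for $x\in P$, $x\sqsubseteq f_{\mathsf{O}(A)}$ iff $x\in\operatorname{Atoms}(P)$ and $\mathsf{O}(x)\subseteq\mathsf{O}(A)$; distinct new elements are incomparable; and no new element is below an element of $P$. *)

(* Defs.v *)
From HB Require Import structures.
From mathcomp Require Import all_boot all_order.
From mathcomp Require Import boolp classical_sets.

Set Implicit Arguments.
Unset Strict Implicit.
Unset Printing Implicit Defensive.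

Import Order.TTheory.
Local Open Scope classical_set_scope.
Local Open Scope order_scope.

Section Posets.
Context {d : Order.disp_t} {P : porderType d}.
Implicit Types (x y z : P) (A D : set P).

Definition overlap x y : Prop := exists z, z <= x /\ z <= y.

(* Atoms and atomicity of the subset D, seen as a poset with the order induced
   by P; the case of the poset P itself is D = setT. *)
Definition atoms D : set P :=
  [set x | D x /\ forall y, D y -> y <= x -> y = x].

Definition atomic D : Prop :=
  forall x, D x -> exists a, atoms D a /\ a <= x.

Definition Opt x : set P := [set y | overlap x y].

Definition Oset A : set P := \bigcup_(x in A) Opt x.

Definition is_fusion x A : Prop :=
  A !=set0 /\ forall y, overlap y x <-> exists z, A z /\ overlap y z.

Definition has_fusion A : Prop := exists x, is_fusion x A.

End Posets.

Definition fusion_complete d (P : porderType d) : Prop :=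
  forall A : set P, A !=set0 -> has_fusion A.

Section Maps.
Context {d d' : Order.disp_t} {P : porderType d} {M : porderType d'}.
Implicit Type f : P -> M.

Definition order_embedding f : Prop := {mono f : x y / x <= y}.

Definition overlap_reflecting f : Prop :=
  forall x y, overlap (f x) (f y) -> overlap x y.

Definition fusion_preserving f : Prop :=
  forall x (A : set P), is_fusion x A -> is_fusion (f x) (f @` A).

Definition fusion_dense f : Prop :=
  forall m, exists A : set P, is_fusion m (f @` A).

Definition fusion_completion f : Prop :=
  [/\ fusion_complete M, order_embedding f, overlap_reflecting f,
      fusion_preserving f & fusion_dense f].

End Maps.

(* The indices O(A) of the new elements of H(P). *)
Definition gaps d (P : porderType d) : set (set P) :=
  [set U | exists A : set P, [/\ A !=set0, ~ has_fusion A & U = Oset A]].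
Arguments gaps {d} P.

(* [inl x] is the element x of P; [inr U], with [val U] = O(A), is the new
   element f_O(A). *)
Definition H d (P : porderType d) : Type := (P + gaps P)%type.
Arguments H {d} P.

Section HOrder.
Context {d : Order.disp_t} {P : porderType d}.

HB.instance Definition _ := Choice.copy (H P) (P + gaps P)%type.

Definition leH (p q : H P) : bool :=
  match p, q with
  | inl x, inl y => x <= y
  | inl x, inr U => `[< atoms setT x /\ Opt x `<=` val U >]
  | inr U, inr V => U == V
  | inr _, inl _ => false
  end.

Fact leH_refl : reflexive leH.
Proof. by case=> [x|U] /=. Qed.

Fact leH_anti : antisymmetric leH.
Proof.
case=> [x|U] [y|V] //=; first by move=> /le_anti ->.
- by rewrite andbF.
- by case/andP=> /eqP ->.
Qed.

Fact leH_trans : transitive leH.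
Proof.
case=> [y|V] [x|U] [z|W] //=.
- exact: le_trans.
- move=> xy /asboolP[aty Oy]; apply/asboolP.
  by rewrite (aty.2 x I xy).
- by move=> + /eqP <-.
- by move=> /eqP ->.
Qed.

HB.instance Definition _ :=
  Order.Le_isPOrder.Build d (H P) leH_refl leH_anti leH_trans.

Definition alpha : P -> H P := inl.

End HOrder.

(* Main.v *)
Require Import Defs.
From mathcomp Require Import all_boot all_order.
From mathcomp Require Import boolp classical_sets.

Import Order.TTheory.

Local Open Scope classical_set_scope.

(** Every new element f_O(A) of H(P) has an element of P below it: [down A] is
    atomic, an atom of [down A] is an atom of P, and it lies below f_O(A).  Hence overlap in H(P) is detected by
    elements of P ([overlap_HP]), and a fusion in H(P) can be tested against
    elements of P only ([is_fusion_alpha_test]).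

    The same atoms show that x in P overlaps f_O(A) in H(P) exactly when x lies
    in O(A) ([overlap_alpha_inr]): if w is below both x and some a in A, an
    atom below w is below x and below f_O(A). So for every nonempty subset A
    of P some m in H(P) overlaps, among the elements of P, exactly those of
    O(A): a fusion of A in P if there is one, and f_O(A) otherwise
    ([fusion_alpha_image]).  The members of a nonempty subset B of H(P)
    overlap, among the elements of P, the same ones as the set of elements of P
    below members of B, so B has a fusion as well.  Density and
    preservation of fusions are read off from the same test. *)

Lemma atoms_down d (P : porderType d) (A : set P) (a : P) :
  atoms (down A) a -> atoms setT a.
Proof.
move=> [/downP[b Ab ab] amin]; split=> // y _ ya; apply: amin => //.
by apply/downP; exists b => //; apply: (le_trans ya).
Qed.

Lemma Opt_refl d (P : porderType d) (x : P) : Opt x x.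
Proof. by exists x. Qed.

Lemma overlapC d (P : porderType d) (x y : P) : overlap x y -> overlap y x.
Proof. by move=> [z [zx zy]]; exists z. Qed.

Lemma sub_Opt d (P : porderType d) (x y : P) :
  (x <= y)%O -> Opt x `<=` Opt y.
Proof.
by move=> xy z [w [wx wz]]; exists w; split=> //; apply: (le_trans wx).
Qed.

Lemma OsetP d (P : porderType d) (A : set P) (y : P) :
  Oset A y <-> exists z, A z /\ overlap y z.
Proof.
split=> [[z Az zy]|[z [Az yz]]]; exists z; last exact: overlapC.
  by split=> //; apply: overlapC.
by [].
Qed.

Lemma le_alpha d (P : porderType d) (p : H P) (x : P) :
  (p <= alpha x)%O -> exists2 y, p = alpha y & (y <= x)%O.
Proof. by case: p => // y yx; exists y. Qed.

Lemma overlap_alpha d (P : porderType d) (x y : P) :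
  overlap (alpha x) (alpha y) <-> overlap x y.
Proof.
split=> [[p [/le_alpha[z -> zx] zy]]|[z [zx zy]]]; first by exists z.
by exists (alpha z).
Qed.

Lemma le_alpha_inr d (P : porderType d) (x : P) (U : gaps P) :
  (alpha x <= (inr U : H P))%O <-> atoms setT x /\ Opt x `<=` val U.
Proof. by split=> [/asboolP|h]; last apply/asboolP. Qed.

(** An element of O(A) has an atom below it whose O is contained in O(A): this
    is where the atomicity of [down A] enters. *)
Lemma Oset_atom d (P : porderType d) (A : set P) (x : P) :
  atomic (down A) -> Oset A x ->
  exists a, [/\ atoms setT a, Opt a `<=` Oset A & (a <= x)%O].
Proof.
move=> Aat [b Ab [w [wb wx]]].
have [|a [aA aw]] := Aat w; first by apply/downP; exists b.
exists a; split; [exact: atoms_down aA| |exact: le_trans wx].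
move=> y ay; exists b => //.
by apply: (@sub_Opt _ _ a) ay; apply: (le_trans aw).
Qed.

Lemma overlap_alpha_inr d (P : porderType d) (x : P) (U : gaps P) :
  (forall A : set P, A !=set0 -> ~ has_fusion A -> atomic (down A)) ->
  overlap (alpha x) (inr U : H P) <-> val U x.
Proof.
move=> hP; split=> [[p [/le_alpha[y -> yx] /le_alpha_inr[_ yU]]]|Ux].
  by apply: yU; exists y.
have [A [A0 nA UA]] := set_valP U.
have [|a [aat aA ax]] := @Oset_atom _ _ A x (hP A A0 nA); first by rewrite -UA.
exists (alpha a); split=> //.
by apply/le_alpha_inr; rewrite UA.
Qed.

Lemma exists_alpha_le d (P : porderType d) (p : H P) :
  (forall A : set P, A !=set0 -> ~ has_fusion A -> atomic (down A)) ->
  exists x, (alpha x <= p)%O.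
Proof.
move=> hP; case: p => [x|U]; first by exists x.
have [A [[b Ab] nA UA]] := set_valP U.
have Ub : val U b by rewrite UA; exists b => //; apply: Opt_refl.
by have /(overlap_alpha_inr _ _ _ _ hP)[q [/le_alpha[y -> _] yU]] := Ub; exists y.
Qed.

Lemma overlap_HP d (P : porderType d) (p q : H P) :
  (forall A : set P, A !=set0 -> ~ has_fusion A -> atomic (down A)) ->
  overlap p q <-> exists2 x, (alpha x <= p)%O & (alpha x <= q)%O.
Proof.
move=> hP; split=> [[r [rp rq]]|[x xp xq]]; last by exists (alpha x).
have [x xr] := exists_alpha_le _ _ r hP.
by exists x; apply: (le_trans xr).
Qed.

(** Fusions in H(P) need only be tested against elements of P: if [p] overlaps
    some [q], then so does an element of P below [p]. *)
Lemma is_fusion_alpha_test d (P : porderType d) (m : H P) (B : set (H P)) :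
  (forall A : set P, A !=set0 -> ~ has_fusion A -> atomic (down A)) ->
  B !=set0 ->
  (forall y : P, overlap (alpha y) m <->
                 exists q, B q /\ overlap (alpha y) q) ->
  is_fusion m B.
Proof.
move=> hP B0 mB; split=> // p; split.
  move=> /(overlap_HP _ _ _ _ hP)[x xp xm].
  have /mB[q [Bq xq]] : overlap (alpha x) m by exists (alpha x).
  by exists q; split=> //; apply: (sub_Opt _ _ _ _ xp).
move=> [q [Bq /(overlap_HP _ _ _ _ hP)[x xp xq]]].
have xm : overlap (alpha x) m.
  by apply/mB; exists q; split=> //; exists (alpha x).
exact: (sub_Opt _ _ _ _ xp).
Qed.

Lemma is_fusion_alpha_image d (P : porderType d) (m : H P) (A : set P) :
  (forall A : set P, A !=set0 -> ~ has_fusion A -> atomic (down A)) ->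
  A !=set0 ->
  (forall y : P, overlap (alpha y) m <-> Oset A y) ->
  is_fusion m (alpha @` A).
Proof.
move=> hP [b Ab] mA; apply: is_fusion_alpha_test => //.
  by exists (alpha b); exists b.
move=> y; rewrite mA OsetP; split=> [[z [Az yz]]|[_ [[z Az <-] yz]]].
  by exists (alpha z); split; [exists z|apply/overlap_alpha].
by exists z; split=> //; apply/overlap_alpha.
Qed.

(** By [is_fusion_alpha_image] such an [m] is a fusion of [alpha @` A]. *)
Lemma fusion_alpha_image d (P : porderType d) (A : set P) :
  (forall A : set P, A !=set0 -> ~ has_fusion A -> atomic (down A)) ->
  A !=set0 ->
  exists m : H P, forall y : P, overlap (alpha y) m <-> Oset A y.
Proof.
move=> hP A0; have [[x [_ xA]]|nA] := pselect (has_fusion A).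
  by exists (alpha x) => y; rewrite overlap_alpha OsetP.
have gA : Oset A \in gaps P by apply/mem_set; exists A.
exists (inr (exist _ (Oset A) gA)) => y.
exact: overlap_alpha_inr.
Qed.

Theorem theorem7p3 (d : Order.disp_t) (P : porderType d)
  (hP : forall A : set P, A !=set0 -> ~ has_fusion A -> atomic (down A)) :
  fusion_completion (alpha : P -> H P).
Proof.
split=> //.
- move=> B [p Bp].
  (* A fusion of the elements of P below members of B is a fusion of B. *)
  pose A := [set x : P | exists2 q, B q & (alpha x <= q)%O].
  have A0 : A !=set0.
    by have [x xp] := exists_alpha_le _ _ p hP; exists x; exists p.
  have [m mA] := fusion_alpha_image _ _ A hP A0.
  exists m; apply: is_fusion_alpha_test => //; first by exists p.
  move=> y; rewrite mA OsetP; split=> [[x [[q Bq xq] yx]]|[q [Bq]]].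
    exists q; split=> //; apply: overlapC; apply: (sub_Opt _ _ _ _ xq).
    by apply/overlap_alpha; apply: overlapC.
  move=> /(overlap_HP _ _ _ _ hP)[x xy xq].
  by exists x; split; [exists q|exists x].
- by move=> x y /overlap_alpha.
- move=> x A [A0 xA]; apply: is_fusion_alpha_image => // y.
  by rewrite overlap_alpha OsetP.
- case=> [x|U].
    exists [set x]; apply: is_fusion_alpha_image => //; first by exists x.
    move=> y; rewrite overlap_alpha OsetP.
    by split=> [yx|[_ [-> ]]] //; exists x.
  have [A [A0 nA UA]] := set_valP U.
  exists A; apply: is_fusion_alpha_image => // y.
  by rewrite overlap_alpha_inr // UA.
Qed.
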